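(* Let $G$ be a finite connected graph and let $u\neq v$ be two vertices of $G$. Then $fix(u,v)=\{u,v\}$ if and only if $u$ and $v$ are twin vertices.
   Context: Graphs are simple and undirected, with vertex set $V(G)$. $\Gamma(G)$ is the automorphism group of $G$, and for a vertex $x$, $\Gamma_x(G)=\{g\in\Gamma(G): g(x)=x\}$ is its stabilizer. The orbit of $v$ is $\mathcal{O}(v)=\{g(v): g\in\Gamma(G)\}$. $V_s(G)$ denotes the set of unordered pairs $(u,v)$ of vertices with $u\neq v$ and $\mathcal{O}(u)=\mathcal{O}(v)$. A vertex $x$ fixes a pair $(u,v)\in V_s(G)$ if for every $h\in\Gamma_x(G)$ we have $h(u)\neq v$ or $h(v)\neq u$. For $(u,v)\in V_s(G)$, $fix(u,v)=\{x\in V(G): x \text{ fixes } (u,v)\}$; for $(u,v)\notin V_s(G)$, $fix(u,v)=\emptyset$ by convention. $d(\cdot,\cdot)$ is the shortest-path distance in $G$. Two vertices $u$ and $v$ are twin if $d(u,w)=d(v,w)$ for all $w\in V(G)\setminus\{u,v\}$. *)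

(* Defs.v *)
From mathcomp Require Import all_boot all_fingroup.

Set Implicit Arguments.
Unset Strict Implicit.
Unset Printing Implicit Defensive.

Record sgraph := SGraph {
  vertex :> finType;
  adj : rel vertex;
  adj_sym : symmetric adj;
  adj_irrefl : irreflexive adj
}.

Definition connected (G : sgraph) : Prop := forall x y : G, connect (@adj G) x y.

Section Graph.
Variable G : sgraph.
Implicit Types (u v w x : G) (g h : {perm G}).

Definition walk_of_length (n : nat) u v : bool :=
  [exists p : n.-tuple G, path (@adj G) u p && (last u p == v)].

(* Least length of a walk from u to v.  If v can be reached from u, this length
   is at most #|G| - 1, so searching below #|G| is enough; otherwise [find]
   returns the junk value #|G|. *)
Definition dist u v : nat :=
  find (fun n => walk_of_length n u v) (iota 0 #|G|).

Definition graph_aut : {set {perm G}} :=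
  [set g : {perm G} | [forall x, forall y, adj (g x) (g y) == adj x y]].

Lemma graph_aut_group_set : group_set graph_aut.
Proof.
apply/group_setP; split=> [|g h].
  by rewrite inE; apply/forallP=> x; apply/forallP=> y; rewrite !perm1.
rewrite !inE => /forallP Hg /forallP Hh.
apply/forallP=> x; apply/forallP=> y; rewrite !permM.
by rewrite (eqP (forallP (Hh _) _)) (eqP (forallP (Hg _) _)).
Qed.
Canonical graph_aut_group := Group graph_aut_group_set.

(* V_s(G); an unordered pair of distinct vertices is a two-element set. *)
Definition Vs : {set {set G}} :=
  [set [set u; v] | u in G, v in G
     & (u != v) && (orbit 'P graph_aut u == orbit 'P graph_aut v)].

Definition fixes x u v : bool :=
  [forall h in ('C_graph_aut[x | 'P])%g, (h u != v) || (h v != u)].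

Definition fix_set u v : {set G} :=
  if [set u; v] \in Vs then [set x | fixes x u v] else set0.

Definition twin u v : Prop :=
  forall w, w != u -> w != v -> dist u w = dist v w.

End Graph.

(* Main.v *)
Require Import Defs.
From mathcomp Require Import all_boot all_fingroup.

(** Both conditions say that the transposition [tperm u v] is an automorphism.

    If [fix_set u v] is [{u, v}], every other vertex [w] fails to fix the pair,
    so some automorphism fixes [w] and swaps [u] and [v]; since automorphisms
    preserve distance ([dist_aut]), [w] is equidistant from [u] and [v].

    Conversely, distance one is adjacency ([dist_eq1]), so twins have the same
    neighbours outside [{u, v}], and swapping them is an automorphism
    ([tperm_twin_aut]).  It puts [u] and [v] in one orbit, and it fixes each
    vertex outside [{u, v}], so that no such vertex fixes the pair.  The
    vertices [u] and [v] always do: a permutation that fixes one of them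
    cannot swap them. *)

Lemma graph_autP (G : sgraph) (g : {perm G}) :
  reflect (forall x y, adj (g x) (g y) = adj x y) (g \in graph_aut G).
Proof.
rewrite inE; apply: (iffP forallP) => [aut_g x y | aut_g x].
  exact/eqP/(forallP (aut_g x)).
by apply/forallP=> y; rewrite aut_g.
Qed.

Lemma walk_of_length_aut (G : sgraph) (g : {perm G}) n (u v : G) :
  g \in graph_aut G ->
  walk_of_length n u v -> walk_of_length n (g u) (g v).
Proof.
move=> /graph_autP aut_g /existsP[p /andP[walk_p /eqP last_p]].
apply/existsP; exists (map_tuple g p).
rewrite /= path_map last_map last_p eqxx andbT.
by rewrite (eq_path (e' := @adj G)).
Qed.

(** Walks are carried forward by [g], and carried back because [g^-1] is an
    automorphism too. *)
Lemma dist_aut (G : sgraph) (g : {perm G}) (u v : G) :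
  g \in graph_aut G -> dist (g u) (g v) = dist u v.
Proof.
move=> aut_g; apply: eq_find => n; apply/idP/idP; last exact: walk_of_length_aut.
rewrite -{2}(permK g u) -{2}(permK g v).
by apply: walk_of_length_aut; rewrite groupV.
Qed.

Lemma dist_eq1 (G : sgraph) (u v : G) :
  u != v -> (dist u v == 1) = adj u v.
Proof.
move=> u_neq_v.
have walk0 : walk_of_length 0 u v = false.
  apply/negbTE/existsPn => p; rewrite tuple0 /=.
  exact: u_neq_v.
have walk1 : walk_of_length 1 u v = adj u v.
  apply/existsP/idP => [[[[|x [|? ?]] //= _]] | adj_uv].
    by rewrite andbT => /andP[adj_ux /eqP <-].
  by exists [tuple v]; rewrite /= adj_uv eqxx.
(* Two distinct vertices make the search range contain both lengths 0 and 1. *)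
have : 1 < #|G| by apply/card_gt1P; exists u, v.
rewrite /dist; case: #|G| => [|[|n]] //= _.
by rewrite walk0 walk1; case: (adj u v).
Qed.

Lemma twin_adj (G : sgraph) (u v w : G) :
  twin u v -> w != u -> w != v -> adj u w = adj v w.
Proof.
move=> twin_uv w_neq_u w_neq_v.
by rewrite -!dist_eq1 1?eq_sym // twin_uv.
Qed.

Lemma tperm_twin_aut (G : sgraph) (u v : G) :
  twin u v -> tperm u v \in graph_aut G.
Proof.
move=> twin_uv; have adj_uv := twin_adj _ _ _ _ twin_uv.
have irr := @adj_irrefl G; have sym := @adj_sym G.
apply/graph_autP => x y.
case: tpermP => [->|->|/eqP x_u /eqP x_v];
  case: tpermP => [->|->|/eqP y_u /eqP y_v]; rewrite ?irr ?(adj_uv y) //.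
- by rewrite sym -adj_uv // sym.
- by rewrite sym adj_uv // sym.
Qed.

Lemma graph_aut_mem_Vs (G : sgraph) (g : {perm G}) (u : G) :
  g \in graph_aut G -> u != g u -> [set u; g u] \in Vs G.
Proof.
move=> aut_g u_neq_gu; apply/imset2P; exists u (g u) => //.
rewrite inE /= u_neq_gu /= eq_sym; apply/eqP/orbit_eqP.
exact: (mem_orbit 'P u aut_g).
Qed.

Lemma not_fixesP (G : sgraph) (x u v : G) :
  reflect (exists2 h : {perm G}, h \in graph_aut G
             & [/\ h x = x, h u = v & h v = u])
          (~~ fixes x u v).
Proof.
apply: (iffP forall_inPn) => [[h] | [h aut_h [hx hu hv]]].
  rewrite inE => /andP[aut_h /astab1P hx].
  rewrite negb_or !negbK => /andP[/eqP hu /eqP hv].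
  by exists h.
exists h; last by rewrite hu hv !eqxx.
by rewrite inE aut_h; apply/astab1P.
Qed.

Lemma fixes_endpoints (G : sgraph) (x u v : G) :
  u != v -> x \in [set u; v] -> fixes x u v.
Proof.
move=> u_neq_v; rewrite !inE => x_uv; apply: contraNT u_neq_v.
by case/not_fixesP=> h _ [hx hu hv]; case/orP: x_uv hx => /eqP ->;
  rewrite ?hu ?hv => ->.
Qed.

Theorem proposition2p4 (G : sgraph) (u v : G) (G_connected : connected G)
    (u_neq_v : u != v) :
  fix_set u v = [set u; v] <-> twin u v.
Proof.
split=> [fix_uv w w_neq_u w_neq_v | twin_uv].
  have : ~~ fixes w u v.
    have := fix_uv; rewrite /fix_set; case: ifP => _ /setP.
      by move/(_ w); rewrite !inE (negbTE w_neq_u) (negbTE w_neq_v) /= => ->.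
    by move/(_ u); rewrite !inE eqxx.
  case/not_fixesP=> h aut_h [hw hu _].
  by rewrite -hu -{2}hw dist_aut.
have aut_t := tperm_twin_aut _ _ _ twin_uv.
have uv_Vs : [set u; v] \in Vs G.
  by rewrite -(tpermL u v) graph_aut_mem_Vs ?tpermL.
rewrite /fix_set uv_Vs; apply/setP=> x; rewrite [LHS]inE.
apply/idP/idP; last exact: fixes_endpoints.
apply: contraLR; rewrite !inE negb_or => /andP[x_neq_u x_neq_v].
apply/not_fixesP; exists (tperm u v) => //.
by rewrite tpermL tpermR tpermD // eq_sym.
Qed.
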